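(* Suppose that $\kappa$ is an infinite cardinal with $\kappa<2^\omega$. Then the Banach space $\ell_1(\kappa)$ does not admit a nontrivial discrete Chebyshev set, i.e., there is no Chebyshev set $D\subseteq\ell_1(\kappa)$ with at least two elements which is discrete.
   Context: For a cardinal $\kappa$, $\ell_1(\kappa)=\{x\in\mathbb{R}^\kappa:\|x\|<\infty\}$ with norm $\|x\|=\sum_{\alpha\in\kappa}|x(\alpha)|$. A subset $C$ of a metric space $M$ is a Chebyshev set if for every $x\in M$ there is exactly one $y\in C$ which is a closest point of $C$ to $x$ (i.e., $d(x,y)\le d(x,c)$ for all $c\in C$). Discrete means discrete in the subspace (norm) topology. Nontrivial means having at least two elements. *)

(* Defs.v *)
From HB Require Import structures.
From mathcomp Require Import all_boot all_order all_algebra.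
From mathcomp Require Import all_classical all_reals all_analysis.

Set Implicit Arguments.
Unset Strict Implicit.
Unset Printing Implicit Defensive.

Import Order.TTheory GRing.Theory Num.Theory.
Import numFieldNormedType.Exports.

Local Open Scope classical_set_scope.
Local Open Scope ring_scope.

(* A cardinal kappa is represented by a type K of that cardinality; the
   choiceType structure is no restriction, since classically every type
   carries one (gen_choiceMixin). *)
Section ell1_pred.
Context (R : realType) (K : choiceType).
Implicit Types x y : K -> R.

Definition ell1_pred : {pred K -> R} :=
  fun x => summable [set: K] (EFin \o x).

Definition ell1_norm x : R := fine (\esum_(a in [set: K]) `|x a|%:E).

Lemma ell1_normE x : x \in ell1_pred ->
  (ell1_norm x)%:E = \esum_(a in [set: K]) `|x a|%:E.
Proof.
by move=> sx; rewrite fineK//; move: sx; rewrite unfold_in /ell1_pred summableE.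
Qed.

Lemma ell1_esumZ (l : R) x : x \in ell1_pred ->
  (\esum_(a in [set: K]) `|l * x a|%:E <= (`|l| * ell1_norm x)%:E)%E.
Proof.
move=> sx; apply: ge_ereal_sup => _ [A [finA _] <-].
have -> : (\sum_(a \in A) `|l * x a|%:E = (`|l| * \sum_(a \in A) `|x a|)%:E)%E.
  by rewrite fsumEFin// mulr_fsumr//; congr EFin; apply: eq_fsbigr => a _;
    rewrite normrM.
rewrite lee_fin ler_wpM2l// -lee_fin ell1_normE// -fsumEFin//.
by apply: ereal_sup_ubound; exists A.
Qed.

Lemma ell1_submod_closed : submod_closed ell1_pred.
Proof.
split=> [|l x y sx sy].
  by rewrite unfold_in /ell1_pred /summable esum1//= => a _; rewrite normr0.
apply: (@summableD K R [set: K] (EFin \o (l *: x)) (EFin \o y)) => //.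
by rewrite /summable (le_lt_trans (ell1_esumZ l sx))// ltry.
Qed.

HB.instance Definition _ :=
  GRing.isSubmodClosed.Build R (K -> R) ell1_pred ell1_submod_closed.

End ell1_pred.

Record ell1 (R : realType) (K : choiceType) := Ell1 {
  ell1_fun :> K -> R ;
  ell1_summable : ell1_fun \in @ell1_pred R K }.

Section ell1.
Context (R : realType) (K : choiceType).
Local Notation l1 := (ell1 R K).

HB.instance Definition _ := [isSub for @ell1_fun R K].
HB.instance Definition _ := [Choice of l1 by <:].
HB.instance Definition _ := [SubChoice_isSubLmodule of l1 by <:].

Let norm (x : l1) : R := ell1_norm x.

Let normD (x y : l1) : norm (x + y) <= norm x + norm y.
Proof.
rewrite -lee_fin EFinD !ell1_normE ?ell1_summable// -esumD//.
by apply: le_esum => a _; rewrite lee_fin ler_normD.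
Qed.

Let norm_eq0 (x : l1) : norm x = 0 -> x = 0.
Proof.
move=> x0; apply/val_inj/funext => a /=; apply/eqP; rewrite -normr_le0 -lee_fin.
rewrite -[leRHS]/(0%:E) -x0 ell1_normE ?ell1_summable//.
apply: esum_ge; exists [set a]; first by split.
by rewrite fsbig_set1.
Qed.

Let normZ (l : R) (x : l1) : norm (l *: x) = `|l| * norm x.
Proof.
have le m (y : l1) : norm (m *: y) <= `|m| * norm y.
  by rewrite -lee_fin ell1_normE ?ell1_summable// ell1_esumZ// ell1_summable.
apply/eqP; rewrite eq_le le/=; have [->|l0] := eqVneq l 0.
  by rewrite normr0 mul0r fine_ge0// esum_ge0.
rewrite -ler_pdivlMl ?normr_gt0// -normfV -{1}(scalerK l0 x); exact: le.
Qed.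

HB.instance Definition _ :=
  Lmodule_isNormed.Build R l1 normD normZ norm_eq0.

Let dist (x y : l1) : R := `|x - y|.
Let dist_ge0 x y : 0 <= dist x y. Proof. exact: normr_ge0. Qed.
Let dist_positivity x y : dist x y = 0 -> x = y.
Proof. by move=> /normr0_eq0/subr0_eq. Qed.
Let ballE (x : l1) d : ball x d = [set y | dist x y < d].
Proof. by rewrite -ball_normE. Qed.

HB.instance Definition _ :=
  @PseudoMetric_isMetric.Build R l1 dist dist_ge0 dist_positivity ballE.

Lemma ell1E (x : l1) : `|x| = fine (\esum_(a in [set: K]) `|x a|%:E).
Proof. by []. Qed.

Lemma ell1_mdistE (x y : l1) : mdist x y = `|x - y|.
Proof. by []. Qed.

End ell1.

Definition chebyshev_set (R : numDomainType) (M : metricType R) (C : set M) :=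
  forall x : M,
    exists! y : M, C y /\ (forall c, C c -> mdist x y <= mdist x c).

(* Here [D] is coerced to the subtype [set_type D], which carries the topology
   induced from [T]. *)
Definition discrete_subset (T : topologicalType) (D : set T) :=
  forall U : set D, open U.

(* Main.v *)
Require Import Defs.
From mathcomp Require Import all_boot all_order all_algebra.
From mathcomp Require Import all_classical all_reals all_analysis.
From mathcomp Require Import lra.

(** Let [c] be the nearest-point map onto a Chebyshev set [D], and call the
fibres of [c] cells.  Cells are closed.  Since the norm of [ell1 R K] is
additive over coordinates, the distance from a point of an axis-parallel line to
a fixed centre [d] is [`|t - p| + w], with [p] and [w] depending only on [d] and
the line; so a point that moves along the line towards [p] moves straight
towards [d] and cannot leave the cell of [d].  Hence every axis-parallel line is
partitioned by the cells into closed intervals, some of them perhaps single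
points.

A partition of the real line into at least two closed intervals has continuum
many members, because between two members there is always a third one, and this
allows a Cantor scheme whose branches end in distinct members
([cantor_classes]).  So, if one axis-parallel line met two cells, [D] would have
at least [2 ^ omega] points.

On the other hand a discrete [D] has at most [kappa] points: assigning to each
[d] a rational, finitely supported vector closer to [d] than half its distance
to the rest of [D] is injective ([discrete_card_le]), and there are at most
[kappa] such vectors because the finite sequences over an infinite set inject
into it ([card_seq_le]).  As [kappa < 2 ^ omega], every axis-parallel
line lies in a single cell.  All finitely supported vectors then have the same
nearest point, by density so has every vector, and [D] is a singleton. *)

Set Implicit Arguments.
Unset Strict Implicit.
Unset Printing Implicit Defensive.

Import Order.TTheory GRing.Theory Num.Theory.
Import numFieldNormedType.Exports.

Local Open Scope classical_set_scope.
Local Open Scope ring_scope.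
Local Open Scope card_scope.

(** * Coordinates and finitely supported vectors *)

Section Coordinates.
Context (R : realType) (K : choiceType).
Implicit Types (x y : ell1 R K) (k : K).

Lemma unit_vec_subproof k : (fun a => (a == k)%:R : R) \in @ell1_pred R K.
Proof.
rewrite unfold_in /ell1_pred /summable (esumID [set k])//.
rewrite setTI esum_set1 ?eqxx ?lee_fin//= esum1 ?adde0 ?ltry// => a [_ /eqP].
by move=> /negbTE ->; rewrite normr0.
Qed.

Definition unit_vec k : ell1 R K := Ell1 (unit_vec_subproof k).

(** All the geometry specific to [ell1] that the proof needs: the norm is the sum
of the modulus of one coordinate and of the norm of what remains once that
coordinate is set to zero. *)
Lemma ell1_norm_split x k :
  `|x| = `|x k| + `|x - x k *: unit_vec k|.
Proof.
have normE y : `|y|%:E = (`|y k|%:E + \esum_(a in ~` [set k]) `|y a|%:E)%E.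
  rewrite -[LHS]/(ell1_norm y)%:E ell1_normE ?ell1_summable// (esumID [set k])//.
  by rewrite !setTI esum_set1.
have yE a : (x - x k *: unit_vec k) a = x a - x k * (a == k)%:R by [].
apply: EFin_inj; rewrite EFinD !normE yE eqxx mulr1 subrr normr0 add0e.
congr (_ + _)%E; apply: eq_esum => a /eqP /negbTE ak.
by rewrite yE ak mulr0 subr0.
Qed.

(** The type [T] of coefficients stands for the reals, to approximate vectors, and
for the rationals, to count the approximations. *)
Definition lincomb (T : Type) (f : T -> R) (s : seq (K * T)) : ell1 R K :=
  \sum_(p <- s) f p.2 *: unit_vec p.1.

Lemma norm_unit_vec k : `|unit_vec k| = 1.
Proof.
rewrite (ell1_norm_split _ k) /= eqxx normr1 scale1r subrr normr0.
by rewrite addr0.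
Qed.

Lemma ell1_norm_sum x (s : seq K) : uniq s ->
  `|x| = \sum_(k <- s) `|x k| + `|x - lincomb id [seq (k, x k) | k <- s]|.
Proof.
elim: s => [_|k s IH] /=; first by rewrite /lincomb !big_nil subr0 add0r.
move=> /andP[ks us]; rewrite (IH us) (ell1_norm_split _ k).
have -> : (x - lincomb id [seq (k, x k) | k <- s]) k = x k.
  rewrite -[LHS]/(x k - lincomb id [seq (k, x k) | k <- s] k).
  suff -> : lincomb id [seq (k, x k) | k <- s] k = 0 by rewrite subr0.
  elim: s ks {IH us} => [|j s IH]; first by rewrite /lincomb big_nil.
  rewrite inE negb_or => /andP[/negbTE kj /IH {}IH].
  rewrite /lincomb /= big_cons.
  rewrite -[LHS]/(x j * (k == j)%:R + lincomb id [seq (k, x k) | k <- s] k).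
  by rewrite IH kj mulr0 addr0.
rewrite {2}/lincomb /= !big_cons /= -/(lincomb id _) opprD.
by rewrite addrA [X in _ = X + _]addrC; congr (_ + `|_|); rewrite addrCA addrC.
Qed.

(** The norm is a supremum of finite sums of moduli, and what such a sum misses is
by [ell1_norm_sum] the norm of the remainder. *)
Lemma lincomb_dense x (e : R) : 0 < e -> exists s, `|x - lincomb id s| < e.
Proof.
move=> e0.
have : ((`|x| - e)%:E < \esum_(a in [set: K]) `|x a|%:E)%E.
  by rewrite -ell1_normE ?ell1_summable// lte_fin; rewrite gtrBl.
move=> /ereal_sup_gt[_ [A [finA _] <-]].
rewrite fsumEFin// lte_fin fsbig_finite//= => lt.
exists [seq (k, x k) | k <- finmap.enum_fset (fset_set A)].
have uA := finmap.fset_uniq (fset_set A).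
by rewrite ltrBlDr (ell1_norm_sum _ uA) ltrD2l in lt.
Qed.

Lemma lincomb_rat_dense x (e : R) : 0 < e ->
  exists s : seq (K * rat), `|x - lincomb ratr s| < e.
Proof.
move=> e0; have [|s xs] := @lincomb_dense x (e / 2); first by rewrite divr_gt0.
suff [q sq] : exists q, `|lincomb id s - lincomb ratr q| < e / 2.
  exists q; rewrite [e]splitr.
  by rewrite (le_lt_trans (ler_distD (lincomb id s) _ _))// ltrD.
elim: s (e / 2) {x e0 xs} (divr_gt0 e0 (ltr0n _ 2)) => [|[k r] s IH] d d0.
  by exists [::]; rewrite /lincomb !big_nil subrr normr0.
have [|q qd] := IH (d / 2); first by rewrite divr_gt0.
have [|p] := @rat_in_itvoo R (r - d / 2) (r + d / 2).
  by rewrite ltrBlDr -addrA -splitr ltrDl.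
rewrite in_itv /= => /andP[p1 p2]; exists ((k, p) :: q).
rewrite /lincomb !big_cons /= opprD addrACA -scalerBl [d]splitr.
rewrite (le_lt_trans (ler_normD _ _))// ltrD// normrZ norm_unit_vec mulr1.
by rewrite ltr_distlC; apply/andP; split; lra.
Qed.

End Coordinates.

(** * Partitions of the line into closed intervals *)

Section IntervalPartition.
Context (R : realType) (T : Type) (c : R -> T).
Hypothesis c_convex : forall a t b, a <= t <= b -> c a = c b -> c t = c a.
Hypothesis c_closed : forall d t,
  (forall e, 0 < e -> exists2 u, c u = d & `|t - u| < e) -> c t = d.

(** The last point of the class of [a] before [b] and the first point thereafter
of the class of [b] belong to these classes, hence differ; nothing strictly
between them is in either class. *)
Lemma third_class a b : a < b -> c a <> c b ->
  exists m, [/\ a < m < b, c m <> c a & c m <> c b].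
Proof.
move=> ab cab.
pose A := [set t | a <= t <= b /\ c t = c a].
have Aa : A a by split; rewrite ?lexx ?ltW.
have supA : has_sup A by split; [exists a | exists b => t [/andP[]]].
have cs : c (sup A) = c a.
  apply: c_closed => e e0; have [t At st] := sup_adherent e0 supA.
  exists t; first by case: At.
  have := ub_le_sup supA.2 At; rewrite ltr_norml; lra.
have as_ : a <= sup A by exact: ub_le_sup supA.2 _ Aa.
have sb : sup A < b.
  rewrite lt_neqAle; apply/andP; split.
    by apply/eqP => sb; apply: cab; rewrite -sb cs.
  by apply: ge_sup; [exists a|move=> t [/andP[]]].
pose B := [set t | sup A <= t <= b /\ c t = c b].
have Bb : B b by split; rewrite ?lexx ?ltW.
have infB : has_inf B by split; [exists b | exists (sup A) => t [/andP[]]].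
have ci : c (inf B) = c b.
  apply: c_closed => e e0; have [t Bt st] := inf_adherent e0 infB.
  exists t; first by case: Bt.
  have := ge_inf infB.2 Bt; rewrite ltr_norml; lra.
have ib : inf B <= b by exact: ge_inf infB.2 _ Bb.
have si : sup A < inf B.
  rewrite lt_neqAle; apply/andP; split.
    by apply/eqP => si; apply: cab; rewrite -cs si.
  by apply: lb_le_inf; [exists b|move=> t [/andP[]]].
exists ((sup A + inf B) / 2); split; first by lra.
- move=> cm; suff : (sup A + inf B) / 2 <= sup A by lra.
  by apply: ub_le_sup supA.2 _ _; split => //; lra.
- move=> cm; suff : inf B <= (sup A + inf B) / 2 by lra.
  by apply: ge_inf infB.2 _ _; split => //; lra.
Qed.

(** Two new points, not one, are needed: the intervals [p.1, q.1] and [q.2, p.2]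
are then separated by a change of class, and each has ends in different
classes, so that the splitting can be repeated in both. *)
Lemma split_interval (p : R * R) : exists q : R * R,
  p.1 < p.2 -> c p.1 <> c p.2 ->
  [/\ p.1 < q.1, q.1 < q.2, q.2 < p.2 &
   [/\ c p.1 <> c q.1, c q.1 <> c q.2 & c q.2 <> c p.2]].
Proof.
have [[p12 cp]|np] := pselect (p.1 < p.2 /\ c p.1 <> c p.2); last first.
  by exists p => ? ?; exfalso; apply: np.
have [m [/andP[pm mp] cm1 cm2]] := third_class p12 cp.
have [n [/andP[mn np] cn1 cn2]] := third_class mp cm2.
by exists (m, n) => _ _ /=; split=> //; split=> // /esym.
Qed.

(** Follow a binary sequence through the iterated splittings; two sequences that
part at some step have limit points on either side of the gap made there, and a
common class would by convexity contain both ends of that gap. *)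
Lemma cantor_classes a b : c a <> c b ->
  exists x : (nat -> bool) -> R, injective (c \o x).
Proof.
move=> cab0; have {a b cab0} [a [b [ab cab]]] : exists a b, a < b /\ c a <> c b.
  have [ab|ba|ab] := ltgtP a b; first by exists a, b.
    by exists b, a; split=> // /esym.
  by rewrite ab in cab0.
have [q qP] := choice split_interval.
(* I s n is the interval reached after reading the first n bits of s. *)
pose I (s : nat -> bool) := fix I n : R * R :=
  if n is n.+1 then if s n then ((q (I n)).2, (I n).2) else ((I n).1, (q (I n)).1)
  else (a, b).
have IP s n : (I s n).1 < (I s n).2 /\ c (I s n).1 <> c (I s n).2.
  elim: n => //= n [IH cIH]; have [? ? ? [? ? ?]] := qP _ IH cIH.
  by case: (s n).
have stepP s n : (I s n).1 <= (I s n.+1).1 /\ (I s n.+1).2 <= (I s n).2.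
  have [IH cIH] := IP s n; have [? ? ? _] := qP _ IH cIH.
  by rewrite /=; case: (s n) => /=; split=> //; lra.
have homoP s n k : (I s n).1 <= (I s (n + k)%N).1 /\ (I s (n + k)%N).2 <= (I s n).2.
  elim: k => [|k [IH1 IH2]]; first by rewrite addn0.
  by rewrite addnS; have [? ?] := stepP s (n + k)%N; split; lra.
have crossP s n m : (I s n).1 <= (I s m).2.
  have [? _] := homoP s n m; have [_ ] := homoP s m n.
  by have [? _] := IP s (n + m)%N; rewrite addnC => ?; lra.
pose x s := sup (range (fun n => (I s n).1)).
have xP s n : (I s n).1 <= x s <= (I s n).2.
  apply/andP; split; last first.
    by apply: ge_sup; [exists (I s 0%N).1; exists 0%N|move=> _ [m _ <-]].
  by apply: ub_le_sup; [exists (I s 0%N).2 => _ [m _ <-]|exists n].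
have branch s t n : I s n = I t n -> s n = false -> t n = true ->
    c (x s) <> c (x t).
  move=> st sn tn cxx; have := xP s n.+1; have := xP t n.+1.
  rewrite /= sn tn /= -st => /andP[qx _] /andP[_ xq].
  have [IH cIH] := IP s n; have [_ lt _ [_ cq _]] := qP _ IH cIH.
  apply: cq; rewrite (c_convex _ cxx) ?(c_convex (a := x s) (t := (q _).2) _ cxx)//.
    by rewrite qx andbT; lra.
  by rewrite xq /=; lra.
exists x => s t /= cxx; apply: contrapT => /eqP st.
have {st}[n0 st0] : exists n, s n != t n.
  by apply: contrapT => h; move/eqP: st; apply; apply/funext => n;
    apply/eqP/negP => /negP sn; apply: h; exists n.
have exn : exists n, s n != t n by exists n0.
have [n st minn] := ex_minnP exn.
have {minn} agree m : (m < n)%N -> s m = t m.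
  by move=> mn; apply/eqP; apply: contraTT mn => /minn; rewrite leqNgt.
have Ist : I s n = I t n.
  elim: n agree {st} => //= n IH agree.
  by rewrite IH ?agree// => m mn; apply: agree; exact: ltnW.
case sn : (s n) st; case tn : (t n) => // _.
  by move: (esym cxx); exact: branch (esym Ist) tn sn.
by move: cxx; exact: branch Ist sn tn.
Qed.

End IntervalPartition.

(** * Finite sequences over an infinite set *)

Lemma card_leT_inj (T U : Type) :
  [set: T] #<= [set: U] <-> exists f : T -> U, injective f.
Proof.
split=> [/card_leP[f]|[f fi]].
  exists (fun x : T => val (f (SigSub (mem_set (I : [set: T] x))))).
  by move=> x y /val_inj/inj e; have /(congr1 val) := e (mem_set I) (mem_set I).
have /injfunPex[F] : exists2 f : T -> U, set_fun setT setT f & set_inj setT f.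
  by exists f => // x y _ _ /fi.
exact: inj_card_le.
Qed.

Lemma chain_pair (T : Type) (F : set (set T)) p q : total_on F subset ->
  (\bigcup_(X in F) X) p -> (\bigcup_(X in F) X) q ->
  exists X, [/\ F X, X p & X q].
Proof.
move=> totF [X FX Xp] [Y FY Yq]; have [XY|YX] := totF _ _ FX FY.
- by exists Y; split=> //; exact: XY.
- by exists X; split=> //; exact: YX.
Qed.

(** Comparability of cardinals: a maximal injective partial relation from [A] to
[B] cannot leave out points on both sides. *)
Lemma injection_total (T : Type) (A B : set T) :
  (exists2 f : T -> T, set_fun A B f & set_inj A f) \/
  (exists2 g : T -> T, set_fun B A g & set_inj B g).
Proof.
pose pinj (G : set (T * T)) := [/\ G `<=` A `*` B,
  forall x y y', G (x, y) -> G (x, y') -> y = y' &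
  forall x x' y, G (x, y) -> G (x', y) -> x = x'].
have [F Fpinj totF|G [[GAB Gf Gi] Gmax]] := @Zorn_bigcup _ pinj.
  split=> [p [X /Fpinj[XAB _ _] /XAB]//|x y y' Fy Fy'|x x' y Fx Fx'].
  - by have [X [/Fpinj[_ Xf _] Xy Xy']] := chain_pair totF Fy Fy'; exact: Xf Xy Xy'.
  - by have [X [/Fpinj[_ _ Xi] Xy Xy']] := chain_pair totF Fx Fx'; exact: Xi Xy Xy'.
have [domG|/existsNP[a /not_implyP[Aa Na]]] :=
    pselect (forall a, A a -> exists b, G (a, b)).
  left; have [a|f fP] := @choice _ _ (fun a b => A a -> G (a, b)).
    by have [/domG[b Gab]|nAa] := pselect (A a); [exists b|exists a].
  exists f => [a /fP/GAB[]//|a a' /set_mem/fP Ga /set_mem/fP Ga' faa'].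
  by apply: Gi Ga _; rewrite faa'.
right; have [b|g gP] := @choice _ _ (fun b a => B b -> G (a, b)); last first.
  exists g => [b /gP/GAB[]//|b b' /set_mem/gP Gb /set_mem/gP Gb' gbb'].
  by apply: Gf Gb _; rewrite gbb'.
have [[a' Ga'b]|Nb] := pselect (exists a', G (a', b)); first by exists a'.
exists a => Bb; exfalso; apply: (Gmax (G `|` [set (a, b)])).
  split=> [|sub]; first by left.
  by apply: Na; exists b; apply: sub; right.
split.
- by move=> p [/GAB//|->].
- move=> x y y' [Gxy|[xa yb]] [Gxy'|[xa' yb']]; first exact: Gf Gxy Gxy'.
  + by exfalso; apply: Na; exists y; rewrite -xa'.
  + by exfalso; apply: Na; exists y'; rewrite -xa.
  + by rewrite yb yb'.
- move=> x x' y [Gxy|[xa yb]] [Gxy'|[xa' yb']]; first exact: Gi Gxy Gxy'.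
  + by exfalso; apply: Nb; exists x; rewrite -yb'.
  + by exfalso; apply: Nb; exists x'; rewrite -yb.
  + by rewrite xa xa'.
Qed.

Section FiniteSequences.
Context (K : choiceType).
Implicit Types (A B : set K) (G : set (seq K * K)).

(** Only nonempty words, so that the empty relation is a coding of the empty
alphabet, as required of the union of an empty chain. *)
Definition words A : set (seq K) := [set s | s <> [::] /\ forall k, k \in s -> A k].

Definition alphabet G : set K := [set k | exists x, G ([:: k], x)].

(** The graph of an injection of the words over a set of letters into that same
set; the letters are recovered from the graph as its one-letter words, which
makes codings stable under unions of chains. *)
Definition coding G := [/\
  forall s x y, G (s, x) -> G (s, y) -> x = y,
  forall s t x, G (s, x) -> G (t, x) -> s = t,
  forall s x, G (s, x) -> words (alphabet G) s /\ alphabet G x &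
  forall s, words (alphabet G) s -> exists x, G (s, x)].

Lemma words_map A B (f : K -> K) s :
  words A s -> set_fun A B f -> words B (map f s).
Proof.
move=> [s0 sA] fAB; split=> [|_ /mapP[k /sA Ak ->]]; last exact: fAB.
by case: s s0 {sA}.
Qed.

Lemma words_map_inj (T : Type) A (f : K -> T) : set_inj A f -> set_inj (words A) (map f).
Proof.
move=> fi s t /set_mem[_ +] /set_mem[_ +].
elim: s t => [|x s IH] [|y t]//= sA tA [/fi xy /IH st].
rewrite xy ?inE; [|by apply: sA; rewrite inE eqxx|by apply: tA; rewrite inE eqxx].
by rewrite st // => k ks; [apply: sA|apply: tA]; rewrite inE ks orbT.
Qed.

(** A coding of the words over [A] also codes the words over any set [B] whose
letters can be spelt by words over [A]: code the letters first, then the word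
that their codes form. *)
Lemma reencode A B (f : seq K -> K) (enc : K -> seq K) :
  set_fun (words A) A f -> set_inj (words A) f ->
  set_fun B (words A) enc -> set_inj B enc ->
  set_fun (words B) A (f \o map (f \o enc)) /\
  set_inj (words B) (f \o map (f \o enc)).
Proof.
move=> fA fi eA ei.
have feA : set_fun B A (f \o enc) by move=> k /eA/fA.
have fei : set_inj B (f \o enc).
  move=> k l kB lB /fi; rewrite !inE => /(_ _ _)/ei -> //; apply: eA; exact: set_mem.
split=> [s sB|s t sB tB /fi e]; first by apply: fA; exact: words_map sB feA.
by apply: (words_map_inj fei) => //; apply: e; rewrite inE;
  apply: words_map feA; exact: set_mem.
Qed.

(** A spelling by words over [A], for [h] mapping the letters outside [A]
injectively into [A]: the length of the word tells the two kinds of letters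
apart. *)
Definition double_outside A (h : K -> K) k :=
  if k \in A then [:: k] else [:: h k; h k].

Lemma double_outside_words A B h : set_fun (B `\` A) A h ->
  set_fun B (words A) (double_outside A h).
Proof.
move=> hA k Bk; rewrite /double_outside; case: ifPn => kA; split=> // j.
  by rewrite inE => /eqP ->; exact: set_mem.
have /hA Ahk : (B `\` A) k by split=> // /mem_set; exact/negP.
by rewrite !inE => /orP[]/eqP ->.
Qed.

Lemma double_outside_inj A B h : set_inj (B `\` A) h ->
  set_inj B (double_outside A h).
Proof.
move=> hi k l /set_mem Bk /set_mem Bl; rewrite /double_outside.
case: ifPn => kA; case: ifPn => lA // -[]// /hi; rewrite !inE => e _.
by apply: e; split=> // /mem_set; exact/negP.
Qed.

(** A word has finitely many letters, so those of a word over the union already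
belong to one member of the chain. *)
Lemma coding_bigcup (F : set (set (seq K * K))) :
  F `<=` coding -> total_on F subset -> coding (\bigcup_(X in F) X).
Proof.
move=> Fc totF.
have alph X : F X -> alphabet X `<=` alphabet (\bigcup_(X in F) X).
  by move=> FX k [x Xkx]; exists x; exists X.
split=> [s x y Fx Fy|s t x Fs Ft|s x [X FX Xsx]|s [s0 sA]].
- by have [X [/Fc[Xf _ _ _] Xx Xy]] := chain_pair totF Fx Fy; exact: Xf Xx Xy.
- by have [X [/Fc[_ Xi _ _] Xs Xt]] := chain_pair totF Fs Ft; exact: Xi Xs Xt.
- have [_ _ /(_ _ _ Xsx)[[s0 sX] xX] _] := Fc _ FX.
  have alphX := alph _ FX.
  by split; [split=> // k /sX/alphX|exact: alphX].
- suff [X FX sX] : exists2 X, F X & words (alphabet X) s.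
    by have [_ _ _ /(_ _ sX)[x Xsx]] := Fc _ FX; exists x; exists X.
  elim: s s0 sA => // k s IH _ sA.
  have [|x [X FX Xk]] := sA k; first by rewrite inE eqxx.
  have [s0|s0] := eqVneq s [::].
    by exists X => //; rewrite s0; split=> // j; rewrite inE => /eqP ->; exists x.
  have [||Y FY [_ sY]] := IH; first exact/eqP.
    by move=> j js; apply: sA; rewrite inE js orbT.
  have [XY|YX] := totF _ _ FX FY.
  + exists Y => //; split=> // j; rewrite inE => /orP[/eqP ->|/sY//].
    by exists x; exact: XY.
  + exists X => //; split=> // j; rewrite inE => /orP[/eqP ->|/sY[y Yj]].
      by exists x.
    by exists y; exact: YX.
Qed.

Lemma coding_graph B (g : seq K -> K) :
  set_fun (words B) B g -> set_inj (words B) g ->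
  let G := [set p | words B p.1 /\ p.2 = g p.1] in coding G /\ alphabet G = B.
Proof.
move=> gB gi G.
have GB : alphabet G = B.
  apply/seteqP; split=> k; first by move=> [x [[_ kB] _]]; exact: kB (mem_head k [::]).
  by move=> Bk; exists (g [:: k]); split=> //; split=> // j; rewrite inE => /eqP ->.
split=> //; split; rewrite ?GB.
- by move=> s x y [_ /= ->] [_ /= ->].
- by move=> s t x [/mem_set sB /= ->] [/mem_set tB /= e]; exact: gi.
- by move=> s x [sB /= ->]; split=> //; exact: gB.
- by move=> s sB; exists (g s).
Qed.

(** Take by Zorn's lemma a maximal coding, with alphabet [A].  If [A] embedded in
its complement, the coding would extend to the words over the union of [A] and of
a copy of [A] in that complement, the codes of the new words being taken in the
copy; this contradicts maximality.  So the complement of [A]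
embeds in [A]; then all letters can be spelt over [A], and the coding of [A]
codes all words. *)
Lemma card_seq_le : infinite_set [set: K] -> exists f : seq K -> K, injective f.
Proof.
move=> Kinf; have [G [[Gf Gi GA Gd] Gmax]] := Zorn_bigcup coding_bigcup.
have [k0 _] := infinite_setN0 Kinf.
set A := alphabet G in GA Gd.
have [s|f fP] := @choice _ _ (fun s x => words A s -> G (s, x)).
  by have [/Gd[x Gx]|nA] := pselect (words A s); [exists x|exists k0].
have fA : set_fun (words A) A f by move=> s /fP/GA[].
have fi : set_inj (words A) f.
  by move=> s t /set_mem/fP Gs /set_mem/fP Gt st; apply: Gi Gs _; rewrite st.
have GE p : G p -> words A p.1 /\ p.2 = f p.1.
  by case: p => s x Gp; have [sA _] := GA _ _ Gp; split=> //; apply: Gf Gp (fP _ sA).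
have max B g : set_fun (words B) B g -> set_inj (words B) g ->
    A `<=` B -> (forall s, words A s -> g s = f s) -> B `<=` A.
  move=> gB gi AB gf; have [Cc CB] := coding_graph gB gi.
  set C := [set p | _] in Cc CB; apply: contrapT => BA.
  apply: (Gmax C) => //; split=> [p /GE[[p0 pA] pf]|CG].
    by split; [split=> // k /pA/AB|rewrite gf].
  apply: BA => k; rewrite -CB => -[x Cx]; exists x; exact: CG.
(* The alphabet is not empty: the words over a countable set can be coded. *)
have [a Aa] : exists a, A a.
  have [h hi] : exists h : nat -> K, injective h.
    by apply/card_leT_inj/infiniteP.
  have [k|h' hK] := @choice _ _ (fun k n => range h k -> h n = k).
    by have [[n _ <-]|nk] := pselect (range h k); [exists n|exists 0%N].
  apply: contrapT => /forallNP A0.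
  have h'i : set_inj (range h) h'.
    by move=> k l /set_mem/hK ek /set_mem/hK el kl; rewrite -ek -el kl.
  apply: (A0 (h 0%N)); apply: (max (range h) (fun s => h (pickle (map h' s)))).
  - by move=> s _; exists (pickle (map h' s)).
  - move=> s t sh th /hi/(pcan_inj pickleK).
    exact: (words_map_inj h'i sh th).
  - by move=> k /A0.
  - by move=> [|k s] [// _ /(_ k)]; rewrite inE eqxx => /(_ isT)/A0.
  - by exists 0%N.
have [[h hA hi]|[h hA hi]] := injection_total A (~` A).
  exfalso; apply: (hA a Aa).
  have [k|h' hK] := @choice _ _ (fun k l => (h @` A) k -> A l /\ h l = k).
    by have [[l Al <-]|nk] := pselect ((h @` A) k); [exists l|exists k].
  set B := A `|` (h @` A).
  have BA k : (B `\` A) k -> A (h' k) /\ h (h' k) = k.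
    by move=> [[//|hAk] _]; exact: hK.
  have h'A : set_fun (B `\` A) A h' by move=> k /BA[].
  have h'i : set_inj (B `\` A) h'.
    by move=> k l /set_mem/BA[_ ek] /set_mem/BA[_ el] kl; rewrite -ek -el kl.
  have [gA gi] := reencode fA fi (double_outside_words h'A) (double_outside_inj h'i).
  set g := (X in set_fun _ _ X) in gA gi.
  apply: (max B (fun s => if s \in words A then f s else h (g s))).
  - move=> s sB; case: ifPn => [/set_mem/fA|_]; first by left.
    by right; exists (g s) => //; exact: gA.
  - move=> s t sB tB; have gAs := gA _ (set_mem sB); have gAt := gA _ (set_mem tB).
    case: ifPn => sA; case: ifPn => tA e.
    + exact: fi.
    + by case: (hA _ gAt); rewrite -e; apply: fA; exact: set_mem.
    + by case: (hA _ gAs); rewrite e; apply: fA; exact: set_mem.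
    + by apply: gi => //; apply: hi e; exact: mem_set.
  - by left.
  - by move=> s sA; rewrite mem_set.
  - by right; exists a.
rewrite -setTD in hA hi.
have [gA gi] := reencode fA fi (double_outside_words hA) (double_outside_inj hi).
(* Adding a letter makes the words nonempty. *)
have wT s : k0 :: s \in words [set: K] by rewrite inE; split.
exists (fun s => (f \o map (f \o double_outside A h)) (k0 :: s)) => s t e.
by have [] := gi _ _ (wT s) (wT t) e.
Qed.

End FiniteSequences.

(** * Cells of a nearest-point map *)

Section NearestPoint.
Context (R : realType) (V : normedModType R) (D : set V) (c : V -> V).
Hypothesis cD : forall x, D (c x).
Hypothesis c_min : forall x d, D d -> `|x - c x| <= `|x - d|.
Hypothesis c_uniq : forall x y, D y -> (forall d, D d -> `|x - y| <= `|x - d|) ->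
  c x = y.

Lemma nearest_closed d x :
  (forall e, 0 < e -> exists2 u, c u = d & `|x - u| < e) -> c x = d.
Proof.
move=> near_d; apply: c_uniq => [|d' Dd'].
  by have [u <- _] := near_d 1 ltr01; exact: cD.
apply/ler_addgt0Pr => e e0.
have [|u cu xu] := near_d (e / 2); first by rewrite divr_gt0.
have := c_min u Dd'; rewrite cu => min_u.
have := ler_distD u x d; have := ler_distD x u d'; rewrite (distrC u x); lra.
Qed.

(** Moving from [x] towards its nearest point brings no other point of [D] closer
than that one, by the triangle inequality. *)
Lemma nearest_between x y : `|x - c x| = `|x - y| + `|y - c x| -> c y = c x.
Proof.
move=> xyc; apply: c_uniq => // d Dd.
by have := c_min x Dd; have := ler_distD y x d; lra.
Qed.

End NearestPoint.

(** * Cells on axis-parallel lines *)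

Section AxisLines.
Context (R : realType) (K : choiceType).
Context (D : set (ell1 R K)) (c : ell1 R K -> ell1 R K).
Hypothesis cD : forall x, D (c x).
Hypothesis c_min : forall x d, D d -> `|x - c x| <= `|x - d|.
Hypothesis c_uniq : forall x y, D y -> (forall d, D d -> `|x - y| <= `|x - d|) ->
  c x = y.

Lemma ell1_norm_axis_line (v d : ell1 R K) k u :
  `|v + u *: unit_vec R k - d| =
  `|u - (d k - v k)| + `|v - d - (v k - d k) *: unit_vec R k|.
Proof.
rewrite (ell1_norm_split _ k).
have -> : (v + u *: unit_vec R k - d) k = u - (d k - v k).
  rewrite -[LHS]/(v k + u * (k == k)%:R - d k) eqxx mulr1; lra.
congr (_ + `|_|); rewrite addrAC -(addrA v) -scalerBl addrAC -scaleNr.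
by congr (_ + _ *: _); lra.
Qed.

Lemma dist_line (v : ell1 R K) k u w :
  `|v + u *: unit_vec R k - (v + w *: unit_vec R k)| = `|u - w|.
Proof.
by rewrite opprD addrACA subrr add0r -scalerBl normrZ norm_unit_vec mulr1.
Qed.

(** [d k - v k] is the parameter of the point of the line closest to the common
nearest point [d] of the two ends; whichever side of it [t] is on, [t] lies
between it and one of the ends. *)
Lemma axis_line_convex v k a t b : a <= t <= b ->
  c (v + a *: unit_vec R k) = c (v + b *: unit_vec R k) ->
  c (v + t *: unit_vec R k) = c (v + a *: unit_vec R k).
Proof.
move=> /andP[at_ tb] cab.
set d := c (v + a *: _) in cab *; have [tp|pt] := leP t (d k - v k).
  apply: (nearest_between cD c_min c_uniq); rewrite -/d dist_line.
  rewrite !ell1_norm_axis_line !ler0_norm; lra.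
rewrite cab; apply: (nearest_between cD c_min c_uniq); rewrite -cab dist_line.
rewrite !ell1_norm_axis_line !ger0_norm; lra.
Qed.

Lemma axis_line_closed v k d t :
  (forall e, 0 < e ->
    exists2 u, c (v + u *: unit_vec R k) = d & `|t - u| < e) ->
  c (v + t *: unit_vec R k) = d.
Proof.
move=> near_d; apply: (nearest_closed cD c_min c_uniq) => e /near_d[u cu tu].
by exists (v + u *: unit_vec R k); rewrite ?dist_line.
Qed.

Lemma axis_lines_constant :
  (forall v k t, c (v + t *: unit_vec R k) = c v) -> forall x, c x = c 0.
Proof.
move=> cline.
have clin s : c (lincomb id s) = c 0.
  elim: s => [|[k r] s IH]; first by rewrite /lincomb big_nil.
  by rewrite /lincomb big_cons addrC cline.
move=> x; apply: (nearest_closed cD c_min c_uniq) => e /(lincomb_dense x)[s xs].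
by exists (lincomb id s).
Qed.

Lemma nonconstant_nearest :
  (exists x, c x <> c 0) ->
  exists x : (nat -> bool) -> ell1 R K, injective (c \o x).
Proof.
move=> [x0 cx0].
have [cline|/existsNP[v /existsNP[k /existsNP[t cvt]]]] :=
    pselect (forall v k t, c (v + t *: unit_vec R k) = c v).
  by case: cx0; exact: axis_lines_constant.
have [|x xi] := cantor_classes (axis_line_convex (v := v) (k := k))
    (axis_line_closed (v := v) (k := k)) (a := t) (b := 0).
  by rewrite scale0r addr0.
by exists (fun s => v + x s *: unit_vec R k).
Qed.

End AxisLines.

(** * Discrete sets are small *)

Lemma discrete_gap (R : realType) (V : normedModType R) (D : set V) d :
  discrete_subset D -> D d ->
  exists2 e : R, 0 < e & forall d', D d' -> `|d - d'| < e -> d' = d.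
Proof.
move=> discD /mem_set Dd.
have [U Uopen Ud] := discD [set SigSub Dd].
have Ud0 : U d by rewrite -[U d]/((set_val @^-1` U) (SigSub Dd)) Ud.
have /nbhs_ballP[e e0 eU] := open_nbhs_nbhs (conj Uopen Ud0).
exists e => // d' /mem_set Dd' dd'.
have : (set_val @^-1` U) (SigSub Dd') by apply: eU; rewrite -ball_normE.
by rewrite Ud => /(congr1 val).
Qed.

Lemma discrete_card_le (R : realType) (K : choiceType) (D : set (ell1 R K)) :
  infinite_set [set: K] -> discrete_subset D ->
  exists g : ell1 R K -> K, set_inj D g.
Proof.
move=> Kinf discD.
have [f fi] := card_seq_le Kinf.
have [h hi] : exists h : nat -> K, injective h.
  by apply/card_leT_inj/infiniteP.
pose code (p : K * rat) := f [:: p.1; h (pickle p.2)].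
have code_inj : injective code.
  by move=> [k q] [l r] /fi[-> /hi/(pcan_inj pickleK) ->].
have [d|e eP] := @choice _ _ (fun (d : ell1 R K) (e : R) =>
    0 < e /\ (D d -> forall d', D d' -> `|d - d'| < e -> d' = d)).
  have [Dd|nDd] := pselect (D d); last by exists 1.
  by have [e e0 ed] := discrete_gap discD Dd; exists e.
have [d|s sP] := @choice _ _ (fun d s => `|d - lincomb ratr s| < e d / 2).
  by apply: lincomb_rat_dense; rewrite divr_gt0// (eP d).1.
exists (fun d => f (map code (s d))) => d d' /set_mem Dd /set_mem Dd'.
move=> /fi/(inj_map code_inj) sdd'.
have dd' : `|d - d'| < e d / 2 + e d' / 2.
  rewrite (le_lt_trans (ler_distD (lincomb ratr (s d)) _ _))// ltrD//.
  by rewrite sdd' distrC.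
have [ed|ed] := leP (e d) (e d').
  by apply: (eP d').2 => //; rewrite distrC; lra.
by apply/esym/(eP d).2 => //; lra.
Qed.

(** * Conclusion *)

Theorem theorem5p3 (R : realType) (K : choiceType)
    (K_infinite : infinite_set [set: K])
    (K_le : [set: K] #<= [set: nat -> bool])
    (K_ne : [set: K] #!= [set: nat -> bool]) :
  ~ exists D : set (ell1 R K),
      [/\ chebyshev_set D,
          exists x y : ell1 R K, [/\ D x, D y & x <> y]
        & discrete_subset D].
Proof.
move=> [D [chebD [d1 [d2 [Dd1 Dd2 d12]]] discD]].
have [c cP] := choice chebD.
have cD x : D (c x) by have [[]] := cP x.
have c_min x d : D d -> `|x - c x| <= `|x - d|.
  by move=> Dd; have [[_ /(_ d Dd)]] := cP x.
have c_uniq x y : D y -> (forall d, D d -> `|x - y| <= `|x - d|) -> c x = y.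
  by move=> Dy y_min; have [_ ] := cP x; exact.
have c_id d : D d -> c d = d.
  by move=> Dd; apply: c_uniq => // d' _; rewrite subrr normr0.
have [|x cx] := nonconstant_nearest cD c_min c_uniq.
  apply: contrapT => /forallNP c0; apply: d12.
  by rewrite -(c_id _ Dd1) -(c_id _ Dd2) (contrapT (c0 d1)) (contrapT (c0 d2)).
have [g gi] := discrete_card_le K_infinite discD.
have K_ge : [set: nat -> bool] #<= [set: K].
  apply/card_leT_inj; exists (g \o (c \o x)) => s t /gi e.
  by apply: cx; apply: e; rewrite inE; exact: cD.
by move/negP: K_ne; apply; rewrite card_eq_le K_le.
Qed.
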